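(* Let $V$ be a complex Hilbert space of finite dimension $N$ with orthonormal basis $\{|u_m\rangle\}_{m=1}^N$. Let $c_1,\dots,c_N \in \mathbb{C}$ be constants with $\sum_m |c_m|^2 = 1$, let $g_1,\dots,g_N$ be real constants, let $b > 0$ be a real constant, and let $f = f(q^1,\dots,q^M)$ be a real-valued differentiable function of real variables $q^1,\dots,q^M$. Define $$|\varphi\rangle = |\varphi(q^1,\dots,q^M)\rangle = \sum_{m=1}^N c_m e^{-i g_m f(q^1,\dots,q^M)/b}\,|u_m\rangle ,$$ let $\hat G$ be the linear operator with $\hat G |u_m\rangle = g_m |u_m\rangle$ for all $m$, and for each $j\in\{1,\dots,M\}$ let $\hat G_j = \frac{\partial f}{\partial q^j}\,\hat G$. Then for each $j$ the operator $\hat G_j$ is Hermitian and $$\hat G_j |\varphi\rangle = i b\, \frac{\partial |\varphi\rangle}{\partial q^j}.$$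
   Context: Here $i=\sqrt{-1}$. The operator $\hat G_j$ depends on the point $(q^1,\dots,q^M)$ through the real factor $\partial f/\partial q^j$. *)

(* Defs.v *)
From HB Require Import structures.
From mathcomp Require Import all_boot all_order all_algebra.
From mathcomp Require Import complex.
From mathcomp Require Import all_classical all_reals all_analysis.

Set Implicit Arguments.
Unset Strict Implicit.
Unset Printing Implicit Defensive.

Import Order.TTheory GRing.Theory Num.Theory.
Import numFieldNormedType.Exports.

Local Open Scope classical_set_scope.
Local Open Scope complex_scope.
Local Open Scope ring_scope.

(* The inner product is linear in its first argument and conjugate-linear in
   the second one, so [inner x y] is the bracket <y|x>. *)
HB.mixin Record hasInnerProduct (R : realType) V
    & CompleteNormedModule R[i] V := {
  inner : {dot V for (@Num.conj R[i])} ;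
  sqr_norm_inner : forall x : V, `|x| ^+ 2 = inner x x
}.

#[short(type="finHilbertType")]
HB.structure Definition FinHilbert (R : realType) :=
  {V of CompleteNormedModule R[i] V & Vector R[i] V & hasInnerProduct R V}.

Definition hermitian_op (R : realType) (V : finHilbertType R) (A : 'End(V)) :=
  forall x y : V, inner (A x) y = inner x (A y).

(* Euler's formula: exp(x + iy) = e^x (cos y + i sin y). *)
Definition cexp (R : realType) (z : R[i]) : R[i] :=
  (expR (complex.Re z))%:C * (cos (complex.Im z) +i* sin (complex.Im z)).

(* Partial derivatives of a vector-valued function of M real variables.  The
   codomain is normed over R[i] whereas the variables are real, so ['D_v phi q]
   does not apply: the definitions are those of [derivable] and [derive], with
   the real increment embedded in R[i]. *)
Section PartialDerivative.
Variables (R : realType) (V : normedModType R[i]) (M : nat).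
Implicit Types (phi : 'rV[R]_M -> V) (q : 'rV[R]_M) (j : 'I_M).

Definition pderivable phi q j :=
  cvg ((fun h : R => (h^-1)%:C *: (phi (h *: 'e_j + q) - phi q)) @ 0^').

Definition pderive phi q j : V :=
  lim ((fun h : R => (h^-1)%:C *: (phi (h *: 'e_j + q) - phi q)) @ 0^').

End PartialDerivative.

Definition phase_state (R : realType) (V : finHilbertType R) (N M : nat)
    (u : N.-tuple V) (c : 'I_N -> R[i]) (g : 'I_N -> R) (b : R)
    (f : 'rV[R]_M -> R) (q : 'rV[R]_M) : V :=
  \sum_(m < N) (c m * cexp (- 'i%C * (g m * f q / b)%:C)) *: u`_m.

(* Main.v *)
(* Euler's formula splits each coefficient of phi into real functions of q, to
   which the real chain rule applies; differentiating brings down the factor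
   - i g_m (df/dq^j) / b, and multiplying by i b leaves the eigenvalue of G_j
   on u_m.  G_j is Hermitian because it is diagonal with real eigenvalues in an
   orthonormal basis. *)
Require Import Defs.
From HB Require Import structures.
From mathcomp Require Import all_boot all_order all_algebra.
From mathcomp Require Import complex.
From mathcomp Require Import all_classical all_reals all_analysis.

Import Order.TTheory GRing.Theory Num.Theory.
Import numFieldNormedType.Exports.

Set Implicit Arguments.
Unset Strict Implicit.
Unset Printing Implicit Defensive.

Local Open Scope classical_set_scope.
Local Open Scope complex_scope.
Local Open Scope ring_scope.

Section InnerProduct.
Variables (R : realType) (V : finHilbertType R).
Implicit Types x y : V.

Lemma inner_suml (I : Type) (r : seq I) (E : I -> V) y :
  inner (\sum_(i <- r) E i) y = \sum_(i <- r) inner (E i) y.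
Proof. exact: linear_sumlz. Qed.

Lemma inner_sumr (I : Type) (r : seq I) (E : I -> V) x :
  inner x (\sum_(i <- r) E i) = \sum_(i <- r) inner x (E i).
Proof. exact: linear_sumr. Qed.

Lemma innerZl k x y : inner (k *: x) y = k * inner x y.
Proof. exact: linearZl_LR. Qed.

Lemma innerZr k x y : inner x (k *: y) = Num.conj k * inner x y.
Proof. exact: linearZr_LR. Qed.

End InnerProduct.

(** [orthonormal] compares each vector only with those after it in the sequence. The induction
    therefore settles indices in increasing order, and Hermitian symmetry gives the reverse
    order. *)
Lemma orthonormal_eq0 (R : realType) (V : finHilbertType R) (s : seq V)
    (i k : nat) :
  orthonormal inner s -> (i < size s)%N -> (k < size s)%N -> i != k ->
  inner s`_i s`_k = 0.
Proof.
move=> /andP[_ os].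
have olt m n : (m < n < size s)%N -> inner s`_m s`_n = 0.
  elim: s os m n => [|v s IHs] /= os m n; first by rewrite ltn0 andbF.
  case/andP: os => /andP[/allP vs _] os.
  case: m n => [|m] [|n] //= mn; last exact: IHs.
  by apply/eqP/vs; rewrite mem_nth.
move=> ilt klt; rewrite neq_ltn => /orP[ik|ki]; first by apply: olt; rewrite ik.
by rewrite hermC /= (olt k i) ?ki// rmorph0 mulr0.
Qed.

(** After expanding [x] and [y] in the basis, orthogonality kills the terms with [i != k]. In the
    others conjugation fixes the real eigenvalue, so it may sit on either side of the bracket. *)
Lemma hermitian_op_diag (R : realType) (N : nat) (V : finHilbertType R)
    (u : N.-tuple V) (a : 'I_N -> R) (A : 'End(V)) :
  basis_of {:V} u -> orthonormal inner u ->
  (forall m : 'I_N, A u`_m = (a m)%:C *: u`_m) -> hermitian_op A.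
Proof.
move=> bu ou Au x y.
rewrite (coord_basis bu (memvf x)) (coord_basis bu (memvf y)).
rewrite ![A (\sum_(_ <- _) _)]linear_sum !inner_suml; apply: eq_bigr => i _.
rewrite !inner_sumr; apply: eq_bigr => k _.
rewrite !linearZ/= !Au !innerZl !innerZr.
have [->|ik] := eqVneq i k; last first.
  by rewrite orthonormal_eq0 ?size_tuple// !mulr0.
have -> : Num.conj (a k)%:C = (a k)%:C by rewrite conj_Creal// complex_real.
by [].
Qed.

(** Naming the limit lets each differentiation rule carry existence and value together;
    [is_pderiveP] separates them at the end. *)
Definition is_pderive (R : realType) (V : normedModType R[i]) (M : nat)
    (phi : 'rV[R]_M -> V) (q : 'rV[R]_M) (j : 'I_M) (l : V) :=
  (h^-1)%:C *: (phi (h *: 'e_j + q) - phi q) @[h --> (0 : R)^'] --> l.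

Section IsPderive.
Variables (R : realType) (V : normedModType R[i]) (M : nat).
Variables (q : 'rV[R]_M) (j : 'I_M).
Implicit Types (phi psi : 'rV[R]_M -> V) (F : 'rV[R]_M -> R).

Lemma is_pderiveP phi l :
  is_pderive phi q j l -> pderivable phi q j /\ pderive phi q j = l.
Proof.
move=> phil; split; first by apply/cvg_ex; exists l.
exact: (cvg_lim (@norm_hausdorff _ V)).
Qed.

Lemma is_pderiveD phi psi l k :
  is_pderive phi q j l -> is_pderive psi q j k ->
  is_pderive (phi \+ psi) q j (l + k).
Proof.
rewrite /is_pderive => dphi dpsi; apply: cvg_trans (cvgD dphi dpsi).
apply: near_eq_cvg; near=> h => /=.
by rewrite fctE -scalerDr opprD addrACA.
Unshelve. all: by end_near. Qed.

Lemma is_pderive_sum (I : Type) (r : seq I) (phi : I -> 'rV[R]_M -> V)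
    (l : I -> V) :
  (forall i, is_pderive (phi i) q j (l i)) ->
  is_pderive (fun p => \sum_(i <- r) phi i p) q j (\sum_(i <- r) l i).
Proof.
rewrite /is_pderive => dphi.
have dsum := @cvg_big V I +%R 0 predT add_continuous R (0 : R)^' r _ l
  _ (fun i _ => dphi i).
apply: cvg_trans (dsum _); apply: near_eq_cvg; near=> h => /=.
by rewrite -sumrB scaler_sumr.
Unshelve. all: by end_near. Qed.

Lemma cvg_real_scaler (T : Type) (F : set_system T) {FF : Filter F}
    (k : T -> R) (a : R) (v : V) :
  k t @[t --> F] --> a -> (k t)%:C *: v @[t --> F] --> a%:C *: v.
Proof.
move=> ka; apply/cvgrPdist_le => -[e e'] /=.
(* The radius is a complex number, and being positive forces its imaginary part to vanish. *)
rewrite ltcE/= => /andP[/eqP -> e0].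
have [r vr] : exists r : R, `|v| = r%:C.
  by apply/complex_realP; exact: normr_real.
have r0 : 0 <= r by rewrite -ler0c -vr.
(* Dividing the radius by [r + 1] instead of [r] also covers [v = 0]. *)
have r1 : 0 < r + 1 by rewrite ltr_wpDl.
move/cvgrPdist_le: ka => /(_ (e / (r + 1)) (divr_gt0 e0 r1)).
apply: filterS => t kt.
rewrite -scalerBl normrZ vr -rmorphB normc_def/= expr0n addr0 sqrtr_sqr.
rewrite -rmorphM lecR (le_trans (ler_wpM2r r0 kt))//.
by rewrite mulrAC ler_pdivrMr// ler_pM2l// lerDl.
Qed.

Lemma is_pderiveZ F (v : V) :
  derivable F q 'e_j ->
  is_pderive (fun p => (F p)%:C *: v) q j (('D_('e_j) F q)%:C *: v).
Proof.
move=> dF.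
have quotF : h^-1 *: (F (h *: 'e_j + q) - F q) @[h --> (0 : R)^'] -->
  'D_('e_j) F q by exact: dF.
apply: cvg_trans (cvg_real_scaler (v := v) quotF).
apply: near_eq_cvg; near=> h => /=.
by rewrite -scalerBl scalerA -rmorphB -rmorphM.
Unshelve. all: by end_near. Qed.

Lemma derive_comp_real F (s : R -> R) (d : R) :
  differentiable F q -> is_derive (F q) 1 s d ->
  derivable (s \o F) q 'e_j /\ 'D_('e_j) (s \o F) q = d * 'D_('e_j) F q.
Proof.
move=> dF sd; have ds : differentiable s (F q).
  by apply/derivable1_diffP; case: sd.
have dsF : differentiable (s \o F) q by exact: differentiable_comp.
split; first exact: diff_derivable.
rewrite !deriveE// diff_comp//= deriv1E; last by case: sd.
by rewrite derive1E derive_val mulrC.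
Qed.

End IsPderive.

(** This shape, real functions times the constants 1 and [- 'i%C], is what [is_pderiveZ] can
    differentiate. *)
Lemma cexp_Ni (R : realType) (x : R) :
  cexp (- 'i%C * x%:C) = (cos x)%:C + (sin x)%:C * (- 'i%C).
Proof.
rewrite /cexp; simpc => /=; rewrite expR0 cosN sinN.
by simpc.
Qed.

(** Reassembles the derivatives of the cosine and sine parts into a multiple of the same
    exponential. *)
Lemma cexp_Ni_deriv (R : realType) (x d : R) :
  (- sin x * d)%:C + (cos x * d)%:C * (- 'i%C) =
  (- 'i%C * d%:C) * cexp (- 'i%C * x%:C).
Proof.
rewrite cexp_Ni; simpc.
by rewrite ![d * _]mulrC.
Qed.

Lemma is_pderive_phase (R : realType) (V : normedModType R[i]) (M : nat)
    (F : 'rV[R]_M -> R) (q : 'rV[R]_M) (j : 'I_M) (v : V) :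
  differentiable F q ->
  is_pderive (fun p => cexp (- 'i%C * (F p)%:C) *: v) q j
    ((- 'i%C * ('D_('e_j) F q)%:C) *: (cexp (- 'i%C * (F q)%:C) *: v)).
Proof.
move=> dF.
have [dcosF DcosF] := derive_comp_real j dF (is_derive_cos (F q)).
have [dsinF DsinF] := derive_comp_real j dF (is_derive_sin (F q)).
(* The constant [- 'i%C] of the sine part is absorbed into the fixed vector, leaving a real
   coefficient. *)
have := is_pderiveD (is_pderiveZ (v := v) dcosF)
  (is_pderiveZ (v := - 'i%C *: v) dsinF).
rewrite DcosF DsinF !scalerA -scalerDl cexp_Ni_deriv.
have -> // : (fun p => cexp (- 'i%C * (F p)%:C) *: v) =
    (fun p => (cos (F p))%:C *: v) \+ (fun p => (sin (F p))%:C *: (- 'i%C *: v)).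
by apply/funext => p /=; rewrite cexp_Ni scalerDl scalerA.
Qed.

Unset Implicit Arguments.

Theorem mainTheorem3 (R : realType) (N M : nat) (V : finHilbertType R)
    (u : N.-tuple V) (c : 'I_N -> R[i]) (g : 'I_N -> R) (b : R)
    (f : 'rV[R]_M -> R) (G : 'End(V)) :
  \dim {:V} = N ->
  basis_of {:V} u ->
  orthonormal inner u ->
  \sum_(m < N) `|c m| ^+ 2 = 1 ->
  0 < b ->
  (forall q : 'rV[R]_M, differentiable f q) ->
  (forall m : 'I_N, G u`_m = (g m)%:C *: u`_m) ->
  forall (j : 'I_M) (q : 'rV[R]_M),
    let Gj : 'End(V) := ('D_('e_j) f q)%:C *: G in
    let phi := phase_state u c g b f in
    [/\ hermitian_op Gj,
        pderivable phi q j &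
        Gj (phi q) = ('i%C * b%:C) *: pderive phi q j].

Proof.
move=> _ bu ou _ b0 df Gu j q Gj phi.
pose th (m : 'I_N) (p : 'rV[R]_M) := g m * f p / b.
have thE m : th m = (g m / b) *: f.
  by apply/funext => p; rewrite /th mulrAC.
have dth m : differentiable (th m) q.
  by rewrite thE; exact: differentiableZ.
have Dth m : 'D_('e_j) (th m) q = g m * 'D_('e_j) f q / b.
  rewrite thE deriveZ; last exact: diff_derivable.
  exact: mulrAC.
have [dphi Dphi] : pderivable phi q j /\ pderive phi q j =
    \sum_(m < N) (- 'i%C * (g m * 'D_('e_j) f q / b)%:C) *:
      ((c m * cexp (- 'i%C * (g m * f q / b)%:C)) *: u`_m).
  apply: is_pderiveP.
  (* The constant [c m] joins the basis vector, so that each summand is a pure phase times a fixed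
     vector. *)
  have -> : phi = fun p => \sum_(m < N)
      cexp (- 'i%C * (th m p)%:C) *: (c m *: u`_m).
    by apply/funext => p; apply: eq_bigr => m _; rewrite scalerA mulrC.
  apply: is_pderive_sum => m.
  rewrite -Dth [c m * _]mulrC -[(_ * c m) *: _]scalerA.
  exact: is_pderive_phase.
split=> //.
  apply: (@hermitian_op_diag _ _ _ _ (fun m => 'D_('e_j) f q * g m) _ bu ou) => m.
  by rewrite scale_lfunE Gu scalerA -rmorphM.
rewrite Dphi scale_lfunE linear_sum/= !scaler_sumr; apply: eq_bigr => m _.
rewrite linearZ/= Gu !scalerA; congr (_ *: _).
(* Here ['i%C * - 'i%C] is 1 and [b] cancels because it is positive. *)
have -> : 'i%C * b%:C * (- 'i%C * (g m * 'D_('e_j) f q / b)%:C) =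
    ('D_('e_j) f q * g m)%:C.
  rewrite mulrACA mulrN -expr2 sqr_i opprK mul1r -rmorphM.
  by rewrite [b * _]mulrC divfK ?gt_eqF// mulrC.
by rewrite mulrAC -rmorphM.
Qed.
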